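(* Let $n\geq 3$. The number of $z$-classes in the symmetric group $S_n$ is $p(n)-\tilde p(n-2)$. Consequently, the number of $z$-classes in $S_n$ is equal to $p(n)-p(n-2)+p(n-3)+p(n-4)-p(n-5)$.
   Context: For a group $G$, two elements $x,y\in G$ are $z$-conjugate if their centralizers $\mathcal{Z}_G(x)$ and $\mathcal{Z}_G(y)$ are conjugate subgroups of $G$; the equivalence classes of this relation are called $z$-classes. $p(m)$ denotes the number of partitions of $m$, with $p(0)=1$ and $p(m)=0$ for $m<0$. $\tilde p(m)$ denotes the number of partitions of $m$ in which neither $1$ nor $2$ appears as a part. *)

(* Defs.v *)
From HB Require Import structures.
From mathcomp Require Import all_boot all_order all_algebra all_fingroup.

Set Implicit Arguments.
Unset Strict Implicit.
Unset Printing Implicit Defensive.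

Import GroupScope.

Definition zconj (gT : finGroupType) (G : {group gT}) (x y : gT) : bool :=
  [exists g in G, 'C_G[x] :^ g == 'C_G[y]].

Definition zclasses (gT : finGroupType) (G : {group gT}) : {set {set gT}} :=
  equivalence_partition (zconj G) G.

(* [equivalence_partition R D] is the set of R-classes of D only when R is an
   equivalence relation, which is the case here. *)
Lemma zconj_equiv (gT : finGroupType) (G : {group gT}) :
  {in G & &, equivalence_rel (zconj G)}.
Proof.
move=> x y z _ _ _; split; first by apply/exists_inP; exists 1; rewrite ?conjsg1.
case/exists_inP=> g Gg /eqP Dy; apply/exists_inP/exists_inP=> [] [h Gh /eqP <-].
  by exists (g^-1 * h); rewrite ?groupM ?groupV // -Dy -conjsgM mulKVg.
by exists (g * h); rewrite ?groupM // conjsgM Dy.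
Qed.

Definition is_intpart (m : nat) (s : seq nat) : bool :=
  [&& sorted geq s, 0 \notin s & sumn s == m].

(* A partition of m has at most m parts, each at most m, so all of them live in
   the finite type of sequences of length <= m over {0, ..., m};
   see [is_intpart_bseq]. *)
Definition intparts (m : nat) : {set m.-bseq 'I_m.+1} :=
  [set s : m.-bseq 'I_m.+1 | is_intpart m [seq val i | i <- s]].

Lemma is_intpart_bseq (m : nat) (s : seq nat) :
  is_intpart m s -> exists2 b, b \in intparts m & [seq val i | i <- b] = s.
Proof.
move=> ps; have /and3P[_ s0 /eqP sm] := ps.
have lem : all (leq^~ m) s.
  apply/allP=> k ks; rewrite -sm; elim: s ks {s0 sm ps} => //= a s IHs.
  rewrite inE => /predU1P[-> | /IHs le_k]; first exact: leq_addr.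
  exact: leq_trans le_k (leq_addl _ _).
have szm : size s <= m.
  rewrite -sm; elim: s s0 {sm ps lem} => //= a s IHs.
  rewrite inE negb_or eq_sym -lt0n => /andP[a0 /IHs les].
  by rewrite -add1n leq_add.
have Ds : [seq val i | i <- [seq inord k : 'I_m.+1 | k <- s]] = s.
  rewrite -map_comp -[RHS]map_id; apply/eq_in_map=> k /(allP lem) le_km /=.
  by rewrite inordK.
have szb : size [seq inord k : 'I_m.+1 | k <- s] <= m by rewrite size_map.
by exists (Bseq szb); rewrite ?inE /= Ds.
Qed.

Definition npart (m : int) : nat :=
  if m is Posz k then #|intparts k| else 0.

Definition npart_no12 (m : nat) : nat :=
  #|[set s in intparts m | (1%N \notin [seq val i | i <- s])
                           && (2%N \notin [seq val i | i <- s])]|.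

(* Main.v *)
Require Import Defs.
From HB Require Import structures.
From mathcomp Require Import all_boot all_order all_algebra all_fingroup.
From mathcomp Require Import zify.

Set Implicit Arguments.
Unset Strict Implicit.
Unset Printing Implicit Defensive.

(** Conjugate permutations have conjugate centralisers, so a z-class is a union
    of conjugacy classes and the question is which cycle types get merged.

    The action of the centraliser C of x nearly determines the cycles of x: a
    point of the C-orbit of a which is fixed by the stabiliser of a in C must
    lie in the x-cycle of a, because another cycle of the same length can be
    rotated on its own (or, for fixed points, exchanged with a third fixed
    point). The argument breaks down in exactly one case: if x has exactly two
    fixed points, then each is fixed by the stabiliser of the other, and C sees
    them as if they formed a 2-cycle ([stab_fixed_cycle], [stab_fixed_two]).

    Hence two permutations with the same centraliser have the same cycle type,
    or else one has exactly two fixed points which the other one exchanges. In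
    the latter case the first has no 2-cycle: the centraliser of the second is
    transitive on the points in 2-cycles, whereas that of the first cannot move
    a fixed point into a 2-cycle ([no_two_cycle]). So the only merging is that
    of the types (2, mu) and (1, 1, mu), where mu has no part equal to 1 or 2;
    and these really are merged, since a permutation of type (2, mu) and its
    product with the transposition of its 2-cycle have the same centraliser
    ([lone2_twin]). The function [split2], which rewrites (2, mu) as (1, 1, mu)
    and fixes all other partitions, is therefore a complete invariant of
    z-classes ([zconj_cycle_type]).

    Its values are the partitions of n which are not of the form (2, mu), and
    removing the part 2 puts the excluded ones in bijection with the partitions
    mu of n - 2 into parts other than 1 and 2: this is the first formula. The
    second one follows by inclusion-exclusion, because the partitions of m
    with a part k correspond to the partitions of m - k. *)

(** * Partitions as sequences *)

Lemma geq_anti : antisymmetric geq.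
Proof. by move=> a b /anti_leq. Qed.

Lemma geq_trans : transitive geq.
Proof. by move=> b a c ba cb; apply: leq_trans ba. Qed.

Lemma geq_total : total geq.
Proof. by move=> a b; apply: leq_total. Qed.

Lemma sorted_perm_geq s t : sorted geq s -> sorted geq t -> perm_eq s t -> s = t.
Proof. exact: (sorted_eq geq_trans geq_anti). Qed.

Lemma sorted_count_geq s t :
    sorted geq s -> sorted geq t ->
    (forall k, count_mem k s = count_mem k t) ->
  s = t.
Proof.
move=> ss st cst; apply: sorted_perm_geq => //.
by rewrite /perm_eq; apply/allP=> k _ /=; rewrite cst.
Qed.

(** Partitions as plain sequences: [rem] and [sort] then act on them directly,
    and cardinals of sets of partitions become [count]s. *)
Definition parts m : seq (seq nat) :=
  [seq [seq val i | i <- (b : m.-bseq 'I_m.+1)] | b <- enum (intparts m)].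

Lemma mem_parts m s : (s \in parts m) = is_intpart m s.
Proof.
apply/mapP/idP => [[b] | /is_intpart_bseq[b bm <-]].
  by rewrite mem_enum inE => bm ->.
by exists b; rewrite ?mem_enum.
Qed.

Lemma parts_uniq m : uniq (parts m).
Proof.
rewrite map_inj_uniq ?enum_uniq // => b c /(inj_map val_inj) bc.
exact: val_inj.
Qed.

Lemma card_parts m (P : pred (seq nat)) :
  #|[set b in intparts m | P [seq val i | i <- (b : m.-bseq 'I_m.+1)]]|
    = count P (parts m).
Proof.
rewrite /parts count_map cardE -size_filter.
apply/perm_size/uniq_perm => [||b].
- exact: enum_uniq.
- exact/filter_uniq/enum_uniq.
by rewrite mem_enum inE andbC [RHS]mem_filter mem_enum.
Qed.

Lemma size_parts m : #|intparts m| = size (parts m).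
Proof. by rewrite size_map -cardE. Qed.

Lemma count_parts_bij m m' (P Q : pred (seq nat)) (f g : seq nat -> seq nat) :
    (forall s, is_intpart m s -> P s ->
       [/\ is_intpart m' (f s), Q (f s) & g (f s) = s]) ->
    (forall s, is_intpart m' s -> Q s ->
       [/\ is_intpart m (g s), P (g s) & f (g s) = s]) ->
  count P (parts m) = count Q (parts m').
Proof.
move=> fP gQ; rewrite -!size_filter -(size_map f).
apply/perm_size/uniq_perm => [| |s].
- rewrite map_inj_in_uniq ?filter_uniq ?parts_uniq // => s t.
  rewrite !mem_filter !mem_parts => /andP[Ps ps] /andP[Pt pt] fst.
  by have [_ _ <-] := fP _ ps Ps; have [_ _ <-] := fP _ pt Pt; rewrite fst.
- by rewrite filter_uniq ?parts_uniq.
rewrite mem_filter mem_parts; apply/mapP/andP => [[t] | [Qs ps]].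
  by rewrite mem_filter mem_parts => /andP[Pt pt] ->; have [] := fP _ pt Pt.
have [pg Pg fg] := gQ _ ps Qs.
by exists (g s); rewrite ?mem_filter ?mem_parts ?Pg.
Qed.

Lemma sumn_sort_cons k s : sumn (sort geq (k :: s)) = k + sumn s.
Proof. by rewrite (perm_sumn (permEl (perm_sort geq _))). Qed.

Lemma sumn_rem k s : k \in s -> sumn s = k + sumn (rem k s).
Proof. by move=> ks; rewrite (perm_sumn (perm_to_rem ks)). Qed.

Lemma sort_cons_rem k s : sorted geq s -> k \in s -> sort geq (k :: rem k s) = s.
Proof.
move=> ss ks; apply: sorted_perm_geq => //; first exact: sort_sorted geq_total _.
by rewrite perm_sort perm_sym perm_to_rem.
Qed.

Lemma rem_sort_cons k s : sorted geq s -> rem k (sort geq (k :: s)) = s.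
Proof.
move=> ss; apply: sorted_perm_geq => //.
  apply: (subseq_sorted geq_trans (rem_subseq _ _)).
  exact: sort_sorted geq_total _.
rewrite -(perm_cons k) perm_sym.
have k_in : k \in sort geq (k :: s) by rewrite mem_sort mem_head.
by rewrite -(permPr (perm_to_rem k_in)) perm_sym perm_sort.
Qed.

(** Removing one part k is a bijection, inverse to inserting k in sorted order.
    This single correspondence serves for the counts of partitions with a part 1
    or 2, with both, and for the partitions merged by [split2]. *)
Lemma count_part_rem k m (P : pred (seq nat)) : 0 < k ->
  count (fun s => (k \in s) && P (rem k s)) (parts (k + m)) = count P (parts m).
Proof.
move=> k_gt0.
apply: (@count_parts_bij _ _ _ _ (rem k) (fun s => sort geq (k :: s))) => s.
  case/and3P=> ss s0 /eqP sm /andP[ks Ps]; split=> //; last exact: sort_cons_rem.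
  apply/and3P; split.
  - exact: (subseq_sorted geq_trans (rem_subseq _ _) ss).
  - by apply: contra s0; apply: mem_rem.
  - by rewrite -(eqn_add2l k) -sumn_rem ?sm.
case/and3P=> ss s0 /eqP sm Ps; split; last exact: rem_sort_cons.
  apply/and3P; split; first exact: sort_sorted geq_total _.
  - by rewrite mem_sort inE negb_or s0 neq_ltn k_gt0.
  - by rewrite sumn_sort_cons sm.
by rewrite mem_sort mem_head rem_sort_cons.
Qed.

(** With integer subtraction no case distinction is needed when m < k: both
    sides vanish. *)
Lemma npart_sub k m : 0 < k ->
  npart (m%:Z - k%:Z)%R = count (fun s : seq nat => k \in s) (parts m).
Proof.
move=> k_gt0; case: (leqP k m) => [le_km | lt_mk].
  rewrite subzn //= size_parts -count_predT -{2}(subnKC le_km).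
  rewrite -(@count_part_rem k) //; apply: eq_count => s /=.
  by rewrite andbT.
have ->: npart (m%:Z - k%:Z)%R = 0.
  rewrite -GRing.opprB subzn ?(ltnW lt_mk) //.
  by rewrite -(prednK (n := k - m)) ?subn_gt0.
apply/esym/eqP; rewrite -leqn0 leqNgt -has_count; apply/hasPn => s.
rewrite mem_parts => /and3P[_ _ /eqP sm]; apply: contraL lt_mk => ks.
by rewrite -leqNgt -sm (sumn_rem ks) leq_addr.
Qed.

Definition no12 (s : seq nat) := (1 \notin s) && (2 \notin s).

(** The types (2, mu) with neither 1 nor 2 in mu. *)
Definition lone2 (s : seq nat) := (1 \notin s) && (count_mem 2 s == 1).

Definition split2 (s : seq nat) :=
  if lone2 s then sort geq [:: 1, 1 & rem 2 s] else s.

Lemma count_lone2 n : 2 <= n ->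
  count lone2 (parts n) = npart_no12 (n - 2).
Proof.
move=> n_ge2; rewrite /npart_no12 (card_parts _ no12) -[RHS](@count_part_rem 2) //.
rewrite subnKC //; apply: eq_count => s; rewrite /lone2 /no12.
have [s2 | s2] /= := boolP (2 \in s); last first.
  by rewrite (count_memPn s2) andbF.
have /seq.permP cs := perm_to_rem s2.
rewrite -!has_pred1 !has_count !cs /=.
by rewrite add0n -!eqn0Ngt add1n eqSS.
Qed.

(** The coefficientwise form of the factor
    (1 - q)(1 - q^2) = 1 - q - q^2 + q^3 which removes the parts 1 and 2 from the
    generating function of partitions. *)
Lemma npart_no12_inclusion_exclusion m : 0 < m ->
  npart_no12 m + npart (m%:Z - 1)%R + npart (m%:Z - 2)%R
    = npart m%:Z + npart (m%:Z - 3)%R.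
Proof.
move=> m_gt0; rewrite /npart_no12 (card_parts _ no12).
have ->: (m%:Z - 3 = (m - 1)%N%:Z - 2%:Z)%R by rewrite -subzn // -GRing.addrA.
rewrite !npart_sub // -(@count_part_rem 1 (m - 1)) // subnKC //= size_parts.
have -> : count (fun s : seq nat => (1 \in s) && (2 \in rem 1 s)) (parts m) =
  count (predI (fun s : seq nat => 1 \in s) (fun s : seq nat => 2 \in s)) (parts m).
  apply: eq_count => s /=; case: (boolP (1 \in s)) => //= s1.
  by rewrite (perm_mem (perm_to_rem s1)) inE.
set has1 := fun s : seq nat => 1 \in s; set has2 := fun s : seq nat => 2 \in s.
rewrite -(count_predC (predU has1 has2)) [RHS]addnAC count_predUI [RHS]addnC.
rewrite -[LHS]addnA; congr (_ + _); apply: eq_count => s /=.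
by rewrite negb_or.
Qed.

Lemma is_intpart_split2 n s : is_intpart n s -> is_intpart n (split2 s).
Proof.
rewrite /split2; case: ifP => // /andP[_ /eqP s2] /and3P[ss s0 /eqP sn].
have {}s2 : 2 \in s by rewrite -has_pred1 has_count s2.
apply/and3P; split; first exact: sort_sorted geq_total _.
- by rewrite mem_sort !inE /=; apply: contra s0; apply: mem_rem.
- by rewrite sumn_sort_cons /= -sn (sumn_rem s2).
Qed.

Lemma split2_not_lone2 s : ~~ lone2 (split2 s).
Proof.
rewrite /split2; case: ifPn => // _.
by rewrite /lone2 mem_sort mem_head.
Qed.

(** * Cycle types of permutations *)

Section CycleType.

Import GroupScope.
Variable T : finType.
Implicit Types (x y : {perm T}) (a b : T) (A B : {set T}).

Definition cycle_type x := sort geq [seq #|A| | A <- enum (porbits x)].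

Lemma porbits_partition x : partition (porbits x) [set: T].
Proof.
have ->: porbits x = orbit 'P <[x]> @: [set: T].
  apply/setP=> A; rewrite /porbits porbitE.
  by apply/imsetP/imsetP=> [] [a _ ->]; exists a.
by apply: orbit_partition; apply/actsP=> a _ b; rewrite !inE.
Qed.

Lemma mem_porbits x a : porbit x a \in porbits x.
Proof. exact: imset_f. Qed.

Lemma cycle_type_part x : is_intpart #|T| (cycle_type x).
Proof.
apply/and3P; split; first exact: sort_sorted geq_total _.
  rewrite mem_sort; apply/mapP => [[A]].
  rewrite mem_enum => /imsetP[a _ ->] /esym/eqP.
  by rewrite (negPf (card_porbit_neq0 _ _)).
rewrite (perm_sumn (permEl (perm_sort geq _))) sumnE big_map big_enum /=.
by rewrite -(card_partition (porbits_partition x)) cardsT.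
Qed.

(** The numbers of points in cycles of each length carry the same information as
    the cycle type, and are easier to compare than multiplicities of parts:
    no choice of cycles is involved. *)
Definition cycle_pts x (k : nat) := [set a | #|porbit x a| == k].

Lemma card_cycle_pts x k : #|cycle_pts x k| = (count_mem k (cycle_type x) * k)%N.
Proof.
have partk : partition [set A in porbits x | #|A| == k] (cycle_pts x k).
  have /and3P[_ tI n0] := porbits_partition x.
  apply/and3P; split.
  - rewrite eqEsubset; apply/andP; split; apply/subsetP=> a.
      case/bigcupP=> A; rewrite inE => /andP[/imsetP[b _ ->] kA].
      by rewrite inE -eq_porbit_mem => /eqP->.
    rewrite inE => ka; apply/bigcupP; exists (porbit x a); last exact: porbit_id.
    by rewrite inE mem_porbits.
  - by apply: trivIsetS tI; apply/subsetP=> A; rewrite inE => /andP[].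
  - by rewrite inE (negPf n0).
rewrite (@card_uniform_partition _ k _ _ _ partk) => [|A].
  2: by rewrite inE => /andP[_ /eqP].
congr (_ * _)%N; rewrite /cycle_type count_sort count_map -size_filter cardE.
apply/perm_size/uniq_perm => [||A].
- exact: enum_uniq.
- exact/filter_uniq/enum_uniq.
by rewrite mem_enum inE andbC [RHS]mem_filter mem_enum.
Qed.

Lemma cycle_type_eq_pts x (s : seq nat) :
    sorted geq s -> 0%N \notin s ->
    (forall k, 0 < k -> #|cycle_pts x k| = (count_mem k s * k)%N) ->
  cycle_type x = s.
Proof.
move=> ss s0 cs; apply: sorted_count_geq => // [|[|k]].
- exact: sort_sorted geq_total _.
- have /and3P[_ t0 _] := cycle_type_part x.
  by rewrite (count_memPn s0) (count_memPn t0).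
by apply/eqP; rewrite -(@eqn_pmul2r k.+1) // -card_cycle_pts cs.
Qed.

Lemma porbit_centraliser x g a : g \in 'C[x] -> porbit x (g a) = g @: porbit x a.
Proof.
move/cent1P=> gx; apply/setP=> b.
have xc i d : (x ^+ i) (g d) = g ((x ^+ i) d).
  by rewrite -!permM (commuteX i gx).
apply/porbitP/imsetP => [[i ->] | [_ /porbitP[i ->] ->]].
  by exists ((x ^+ i) a); rewrite ?mem_porbit.
by exists i.
Qed.

Lemma card_porbit_centraliser x g a :
  g \in 'C[x] -> #|porbit x (g a)| = #|porbit x a|.
Proof.
by move=> gx; rewrite porbit_centraliser // card_imset //; apply: perm_inj.
Qed.

Lemma card_porbit1 x a : (#|porbit x a| == 1%N) = (x a == a).
Proof.
apply/cards1P/eqP => [[b xa] | xa].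
  have := porbit_id x a; have := mem_porbit x 1 a.
  by rewrite expg1 xa !inE => /eqP-> /eqP.
exists a; apply/setP=> b; rewrite inE; apply/porbitP/eqP => [[i ->] | ->].
  by elim: i => [|i IH]; rewrite ?perm1 // expgSr permM IH.
by exists 0; rewrite perm1.
Qed.

Lemma porbitJ x g a : porbit (x ^ g) (g a) = g @: porbit x a.
Proof.
apply/setP=> b; apply/porbitP/imsetP => [[i ->] | [_ /porbitP[i ->] ->]].
  by exists ((x ^+ i) a); rewrite ?mem_porbit // -conjXg permJ.
by exists i; rewrite -conjXg permJ.
Qed.

Lemma cycle_typeJ x g : cycle_type (x ^ g) = cycle_type x.
Proof.
have /and3P[ss s0 _] := cycle_type_part x.
apply: cycle_type_eq_pts => // k _; rewrite -card_cycle_pts.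
rewrite -[RHS](card_imset _ (@perm_inj _ g)); apply: eq_card => b.
rewrite -(permKV g b) mem_imset ?inE; last exact: perm_inj.
by rewrite porbitJ card_imset //; apply: perm_inj.
Qed.

Lemma eq_porbit_exp x a i j :
  ((x ^+ i) a == (x ^+ j) a) = (i == j %[mod #|porbit x a|]).
Proof.
set m := #|_|; have m_gt0 : 0 < m by rewrite lt0n card_porbit_neq0.
have xmod k : (x ^+ k) a = (x ^+ (k %% m)) a.
  rewrite {1}(divn_eq k m) expgD permM; congr (fun_of_perm _ _); move: (k %/ m) => q.
  have xm : (x ^+ m) a = a by rewrite permX iter_porbit.
  by elim: q => [|q IH]; rewrite ?perm1 // mulSn expgD permM xm.
have nthx k : (x ^+ k) a = nth a (traject x a m) (k %% m).
  by rewrite nth_traject ?ltn_mod // -permX -xmod.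
by rewrite !nthx nth_uniq ?size_traject ?ltn_mod ?uniq_traject_porbit.
Qed.

(** Listing the cycles of both permutations by decreasing length puts cycles of
    the same length at the same position. *)
Lemma exists_cycle_matching x y : cycle_type x = cycle_type y ->
  exists f : {set T} -> {set T},
    {in porbits x, forall A, f A \in porbits y /\ #|f A| = #|A|}
    /\ {in porbits x &, injective f}.
Proof.
rewrite /cycle_type !sort_map; set le := relpre _ _.
set sx := sort le _; set sy := sort le _ => card_sxy.
have size_sxy : size sx = size sy by rewrite -!(size_map (fun A => #|A|)) card_sxy.
have mem_sx A : (A \in sx) = (A \in porbits x) by rewrite mem_sort mem_enum.
have mem_sy A : (A \in sy) = (A \in porbits y) by rewrite mem_sort mem_enum.
have uniq_sy : uniq sy by rewrite sort_uniq enum_uniq.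
exists (fun A => nth set0 sy (index A sx)); split=> [A | A B].
  rewrite -mem_sx => Ax.
  have lt_A : index A sx < size sy by rewrite -size_sxy index_mem.
  split; first by rewrite -mem_sy mem_nth.
  rewrite -[RHS](congr1 (fun B => #|B|) (nth_index set0 Ax)).
  by rewrite -!(nth_map _ 0%N (fun B => #|B|)) ?index_mem // card_sxy.
rewrite -!mem_sx => Ax Bx /eqP; rewrite nth_uniq -?size_sxy ?index_mem // => /eqP.
exact: index_inj.
Qed.

(** Choose a base point in every cycle and match the cycles by length; the
    conjugating permutation sends the i-th iterate of a base point to the i-th
    iterate of the matching one. This is well defined and injective because
    iterates of a base point agree exactly when the exponents agree modulo the
    length, which is common to matched cycles. *)
Lemma cycle_type_conj x y : cycle_type x = cycle_type y -> exists g, x ^ g = y.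
Proof.
case/exists_cycle_matching=> f [fP f_inj].
have [a0 _ | noT] := pickP (mem T); last first.
  by exists 1; apply/permP=> a; have := noT a.
have base z : exists r : {set T} -> T, {in porbits z, forall A, porbit z (r A) = A}.
  apply: (@fin_all_exists _ _ (fun A a => A \in porbits z -> porbit z a = A)) => A.
  by have [/imsetP[a _ ->] | _] := boolP (A \in porbits z); [exists a | exists a0].
have [[r rP] [s sP]] := (base x, base y).
have /fin_all_exists[k kP] a : exists k, a = (x ^+ k) (r (porbit x a)).
  by apply/porbitP; rewrite -eq_porbit_mem rP ?mem_porbits.
pose h a := (y ^+ k a) (s (f (porbit x a))).
(* Both exponents are read modulo the common length of matched cycles. *)
have same_base a i j :
    ((y ^+ i) (s (f (porbit x a))) == (y ^+ j) (s (f (porbit x a))))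
      = ((x ^+ i) (r (porbit x a)) == (x ^+ j) (r (porbit x a))).
  have [fy fc] := fP _ (mem_porbits x a).
  by rewrite !eq_porbit_exp sP // fc rP ?mem_porbits.
have h_inj : injective h.
  move=> a b hab; have xab : porbit x a = porbit x b.
    apply: f_inj; rewrite ?mem_porbits // -[LHS]sP -1?[RHS]sP.
    - rewrite -(porbit_perm y (k a)) -[in RHS](porbit_perm y (k b)).
      by rewrite [X in porbit y X]hab.
    - by case: (fP _ (mem_porbits x b)).
    - by case: (fP _ (mem_porbits x a)).
  by apply/eqP; rewrite (kP a) (kP b) xab -same_base -{1}xab; apply/eqP.
exists (perm h_inj); apply/permP=> b; rewrite -(permKV (perm h_inj) b).
move: (_ b) => a; rewrite permJ !permE /h -permM -expgSr.
have ->: porbit x (x a) = porbit x a by rewrite (porbit_perm x 1).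
apply/eqP; rewrite same_base expgSr permM -(kP a).
by rewrite -(porbit_perm x 1 a) expg1 -(kP (x a)).
Qed.

(** On the disjoint union U of cyclic index sets of sizes s_0, s_1, ..., the
    cyclic successor in each component has the parts of s as its cycle lengths.
    As U has the cardinality of T, it can be transported to T. *)
Lemma cycle_type_onto s : is_intpart #|T| s -> exists x, cycle_type x = s.
Proof.
case/and3P=> ss s0 /eqP sT.
pose J (i : 'I_(size s)) := 'I_(nth 0%N s i); pose U := {i : 'I_(size s) & J i}.
have cardU : #|{: U}| = #|T|.
  rewrite card_tagged sumnE big_map -sT sumnE (big_nth 0%N) big_mkord big_enum.
  by apply: eq_bigr => i _; rewrite card_ord.
have [f [h fK hK]] : exists f : T -> U, exists2 h, cancel f h & cancel h f.
  exists (fun a => enum_val (cast_ord (esym cardU) (enum_rank a))).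
  exists (fun u => enum_val (cast_ord cardU (enum_rank u))) => u.
    by rewrite enum_valK cast_ordKV enum_rankK.
  by rewrite enum_valK cast_ordK enum_rankK.
pose next (u : U) : U := Tagged J (ordS (tagged u)).
have next_inj : injective next.
  move=> [i j] [i' j']; rewrite /next /= => /eqP eq_next.
  have Di : i = i' by move/eqP/(congr1 tag): eq_next.
  rewrite -{i'}Di in j' eq_next *.
  move: eq_next; rewrite eq_Tagged /= => /eqP/ordS_inj->.
  by [].
have s_inj : injective (fun a => h (next (f a))).
  by apply: inj_comp (can_inj hK) (inj_comp next_inj (can_inj fK)).
have card_fibres (P : pred 'I_(size s)) :
    #|[set b | P (tag (f b))]| = \sum_(i | P i) nth 0%N s i.
  rewrite -sum1_card (reindex h) /=; last by exists f => u _; [apply: hK | apply: fK].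
  rewrite (eq_bigl (fun u => P (tag u) && true)) => [|u]; last by rewrite inE hK andbT.
  rewrite -(@sig_big_dep _ _ _ _ (fun i : 'I_(size s) => 'I_(nth 0%N s i)) P
             (fun i j => true) (fun i j => 1%N)) /=.
  by apply: eq_bigr => i _; rewrite sum_nat_const card_ord muln1.
have iter_next i (j : J i) k :
    iter k next (Tagged J j) = Tagged J (iter k (@ordS _) j).
  by elim: k => //= k ->.
have iter_ordS m (j : 'I_m) k : iter k (@ordS _) j = (j + k) %% m :> nat.
  elim: k => [|k IH]; first by rewrite addn0 modn_small.
  by rewrite iterS /= IH -addn1 modnDml addn1 addnS.
pose x := perm s_inj.
have xX k a : (x ^+ k) a = h (iter k next (f a)).
  elim: k => [|k IH]; first by rewrite perm1 fK.
  by rewrite expgSr permM IH permE hK.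
have porbit_x a : porbit x a = [set b | tag (f b) == tag (f a)].
  apply/setP=> b; rewrite inE; apply/porbitP/eqP => [[k ->] | ].
    by rewrite xX hK; case: (f a) => i j; rewrite iter_next.
  case Da: (f a) => [i j]; case Db: (f b) => [i' j'] /= Di.
  (* The number of successor steps from j to j' modulo the size of their
     component, written so that no subtraction is truncated. *)
  rewrite -{i}Di in j Da; exists (j' + (nth 0%N s i' - j))%N.
  rewrite xX Da iter_next -[b]fK Db; congr (h (Tagged J _)).
  apply: ord_inj; rewrite iter_ordS addnCA subnKC 1?ltnW // modnDr.
  by rewrite modn_small.
have card_x a : #|porbit x a| = nth 0%N s (tag (f a)).
  by rewrite porbit_x (card_fibres (pred1 _)) big_pred1_eq.
exists x; apply: cycle_type_eq_pts => // k _.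
have ->: cycle_pts x k = [set b | nth 0%N s (tag (f b)) == k].
  by apply/setP=> b; rewrite !inE card_x.
rewrite (card_fibres (fun i => nth 0%N s i == k)).
rewrite (eq_bigr (fun=> k)) => [|i /eqP //]; rewrite sum_nat_const; congr (_ * _)%N.
rewrite -sum1_count (big_nth 0%N) big_mkord -sum1_card.
by apply: eq_bigl => i.
Qed.

End CycleType.

(** * Permutations with the same centraliser *)

Section Centraliser.

Import GroupScope.
Variable T : finType.
Implicit Types (x y g : {perm T}) (a b d : T) (A B : {set T}).
Implicit Types H : {set {perm T}}.

(** Intended for H the centraliser of a permutation x: it is defined from H alone,
    but is in general the cycle of a under x. *)
Definition stab_fixed H a := 'Fix_(orbit 'P H a | 'P)('C_H[a | 'P]).

Lemma stab_fixedP H a b :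
  reflect ((exists2 g, g \in H & g a = b)
           /\ {in H, forall g, g a = a -> g b = b})
          (b \in stab_fixed H a).
Proof.
rewrite inE; apply: (iffP andP) => [[/orbitP Hb /afixP fb] | [Hb fb]]; split.
- by [].
- by move=> g Hg ga; apply: fb; rewrite inE Hg; apply/astab1P.
- exact/orbitP.
- by apply/afixP=> g /setIP[Hg /astab1P ga]; apply: fb.
Qed.

Lemma mem_cycle_pts x g k a :
  g \in 'C[x] -> (g a \in cycle_pts x k) = (a \in cycle_pts x k).
Proof. by move=> gx; rewrite !inE card_porbit_centraliser. Qed.

Lemma mem_cycle_pts1 x a : (a \in cycle_pts x 1) = (x a == a).
Proof. by rewrite inE card_porbit1. Qed.

Lemma tperm_centralises x a b : x a = a -> x b = b -> tperm a b \in 'C[x].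
Proof. by move=> xa xb; apply/cent1P/commgP/conjg_fixP; rewrite tpermJ xa xb. Qed.

Lemma tperm_commute_pair g a b : a != b ->
  g a \in [set a; b] -> g b \in [set a; b] -> commute (tperm a b) g.
Proof.
move=> ab; have : g a != g b by rewrite (inj_eq perm_inj).
move=> gab; rewrite !inE => ga gb; apply/commgP/conjg_fixP; rewrite tpermJ.
case/orP: ga gab => /eqP->; case/orP: gb => /eqP->; rewrite ?eqxx // => _.
exact: tpermC.
Qed.

(** If b is in the orbit of a but not in its cycle, then some element of the
    centraliser fixes a and moves b: the restriction of x to the cycle of b
    or, when a and b are fixed points, the exchange of b with a third fixed
    point. *)
Lemma stab_fixed_cycle x a :
    ~~ ((x a == a) && (#|cycle_pts x 1| == 2)) ->
  stab_fixed 'C[x] a = porbit x a.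
Proof.
move=> generic; apply/setP=> b; apply/stab_fixedP/idP; last first.
  case/porbitP=> k ->; split; first by exists (x ^+ k); rewrite // groupX ?cent1id.
  by move=> g /cent1P gx ga; rewrite -permM -(commuteX k gx) permM ga.
case=> -[g0 g0x g0a] fb; apply: contraR generic => ab.
have [xb | xb] := eqVneq (x b) b; last first.
  have xN : x \in 'N(porbit x b | 'P).
    apply/astabsP=> d; rewrite /= apermE -!eq_porbit_mem.
    by rewrite (porbit_perm x 1).
  case/eqP: xb; rewrite -(restr_permE xN (porbit_id x b)); apply: fb.
    exact/cent1P/restr_perm_commute.
  by apply: (out_perm (restr_perm_on _ _)); rewrite porbit_sym.
have a1 : a \in cycle_pts x 1 by rewrite -(mem_cycle_pts _ _ g0x) g0a mem_cycle_pts1 xb.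
have xa : x a = a by apply/eqP; rewrite -mem_cycle_pts1.
rewrite xa eqxx /=; have b1 : b \in cycle_pts x 1 by rewrite mem_cycle_pts1 xb.
have neq_ab : b != a by apply: contraNneq ab => ->; apply: porbit_id.
suff ->: cycle_pts x 1 = [set a; b] by rewrite cards2 (eq_sym a) neq_ab.
apply/setP=> d; rewrite [RHS]inE !in_set1.
apply/idP/idP=> [d1 | /orP[]/eqP-> //].
have xd : x d = d by apply/eqP; rewrite -mem_cycle_pts1.
apply: contraT; rewrite negb_or => /andP[da db].
case/eqP: (db); rewrite -{1}(tpermL b d); apply: fb; last by rewrite tpermD.
exact: tperm_centralises.
Qed.

(** Of two fixed points, a permutation fixing one and preserving the pair must fix
    the other. *)
Lemma stab_fixed_two x a : x a = a -> #|cycle_pts x 1| = 2 ->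
  stab_fixed 'C[x] a = cycle_pts x 1.
Proof.
move=> xa two; have a1 : a \in cycle_pts x 1 by rewrite mem_cycle_pts1 xa.
apply/setP=> b; apply/stab_fixedP/idP=> [[[g gx <-] _] | b1].
  by rewrite mem_cycle_pts.
have xb : x b = b by apply/eqP; rewrite -mem_cycle_pts1.
split; first by exists (tperm a b); rewrite ?tpermL ?tperm_centralises.
move=> g gx ga; have [-> // | ab] := eqVneq b a.
have Dpts : cycle_pts x 1 = [set a; b].
  apply/esym/eqP; rewrite eqEcard two cards2 eq_sym ab andbT.
  by apply/subsetP=> d /set2P[]->.
have : g b \in [set a; b] by rewrite -Dpts mem_cycle_pts.
by rewrite !inE -{1}ga (inj_eq perm_inj) (negPf ab) => /eqP.
Qed.

Definition stab_fixed_pts H k := [set a | #|stab_fixed H a| == k].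

Lemma stab_fixed_pts_cycle x k : #|cycle_pts x 1| != 2 ->
  stab_fixed_pts 'C[x] k = cycle_pts x k.
Proof.
move=> not2; apply/setP=> a.
by rewrite !inE stab_fixed_cycle // negb_and not2 orbT.
Qed.

(** The two fixed points are counted with the 2-cycles. *)
Lemma card_stab_fixed_pts_two x k : #|cycle_pts x 1| = 2 -> 0 < k ->
  #|stab_fixed_pts 'C[x] k| =
    if k == 1%N then 0 else if k == 2 then 2 + #|cycle_pts x 2| else #|cycle_pts x k|.
Proof.
move=> two k_gt0.
have lvl a : #|stab_fixed 'C[x] a| =
    if #|porbit x a| == 1%N then 2 else #|porbit x a|.
  rewrite card_porbit1; case: eqVneq => [xa | xa]; first by rewrite stab_fixed_two.
  by rewrite stab_fixed_cycle // (negPf xa).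
case: eqP => [-> | k1].
  apply/eqP; rewrite cards_eq0; apply/eqP/setP=> a; rewrite !inE lvl.
  by case: ifP.
case: eqP => [-> | k2]; last first.
  apply: eq_card => a; rewrite !inE lvl; case: (#|porbit x a| =P 1%N) => // ->.
  by rewrite !(eq_sym _ k) (introF eqP k1) (introF eqP k2).
rewrite -[X in X + _]two -cardsUI addnC [X in X + _]eq_card0 ?add0n => [|a].
  by apply: eq_card => a; rewrite !inE lvl; case: ifP.
by rewrite !inE; case: eqP => // ->.
Qed.

Lemma cycle_type_centraliser x y : 'C[x] = 'C[y] ->
  (#|cycle_pts x 1| == 2) = (#|cycle_pts y 1| == 2) ->
  cycle_type x = cycle_type y.
Proof.
move=> Cxy; have [x2 /esym/eqP y2 | x2 /esym/negbT y2] := eqVneq #|cycle_pts x 1| 2.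
  have /and3P[ss s0 _] := cycle_type_part y.
  apply: cycle_type_eq_pts => // k k_gt0; rewrite -card_cycle_pts.
  have := card_stab_fixed_pts_two y2 k_gt0; rewrite -Cxy card_stab_fixed_pts_two //.
  case: eqP => [-> _ | _]; first by rewrite x2 y2.
  by case: eqP => [-> /addnI | _].
have /and3P[ss s0 _] := cycle_type_part y.
apply: cycle_type_eq_pts => // k k_gt0; rewrite -card_cycle_pts.
by rewrite -(stab_fixed_pts_cycle _ x2) -(stab_fixed_pts_cycle _ y2) Cxy.
Qed.

(** Let a be a fixed point and d in a 2-cycle of x. Then a and d both lie in
    2-cycles of y, so the product of the transposition t of a and d by its
    y-conjugate centralises y. It would send a to d, but an element of the
    centraliser of x preserves the lengths of x-cycles. *)
Lemma no_two_cycle x y : 'C[x] = 'C[y] ->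
  #|cycle_pts x 1| = 2 -> #|cycle_pts y 1| != 2 -> cycle_pts x 2 = set0.
Proof.
move=> Cxy x2 y2; apply/setP=> d; rewrite [RHS]inE; apply/negP=> dx.
have /card_gt0P[a ax] : 0 < #|cycle_pts x 1| by rewrite x2.
have ptsy b : #|stab_fixed 'C[x] b| = #|porbit y b|.
  by rewrite Cxy stab_fixed_cycle // negb_and y2 orbT.
have xa : x a = a by apply/eqP; rewrite -mem_cycle_pts1.
have ya2 : #|porbit y a| = 2 by rewrite -ptsy stab_fixed_two.
have xd : x d != d by move: dx; rewrite -card_porbit1 inE => /eqP->.
have yd2 : #|porbit y d| = 2.
  by rewrite -ptsy stab_fixed_cycle ?negb_and ?xd //; apply/eqP; rewrite inE in dx.
have yC : y \in 'C[x] by rewrite Cxy cent1id.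
have sep b c : b \in cycle_pts x 1 -> c \in cycle_pts x 2 -> (c == b) = false.
  by move=> b1 c2; apply: contraTF b1 => /eqP <-; move: c2; rewrite !inE => /eqP->.
have yax : y a \in cycle_pts x 1 by rewrite mem_cycle_pts.
have ydx : y d \in cycle_pts x 2 by rewrite mem_cycle_pts.
have yy b : #|porbit y b| = 2 -> y (y b) = b.
  by move=> b2; have := iter_porbit y b; rewrite b2.
have ya : y a != a by rewrite -card_porbit1 ya2.
have yd : y d != d by rewrite -card_porbit1 yd2.
pose t := tperm a d; have tyy : (t ^ y) ^ y = t by rewrite !tpermJ !yy.
(* The transpositions t and t ^ y have disjoint supports, as y preserves both
   the fixed points and the 2-cycles of x. *)
have tty : t ^ (t ^ y) = t.
  have [yda dya] : y d != a /\ y a != d by rewrite [y a == d]eq_sym !sep.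
  by rewrite [t ^ y]tpermJ tpermJ !tpermD.
have tyC : t * t ^ y \in 'C[x].
  rewrite Cxy; apply/cent1P/commgP/conjg_fixP.
  by rewrite conjMg tyy; apply/esym/commgP/conjg_fixP.
have := mem_cycle_pts 1 a tyC; rewrite ax permM tpermL tpermJ tpermD.
- by rewrite inE; move: dx; rewrite inE => /eqP->.
- by rewrite eq_sym sep.
- by [].
Qed.

(** The two fixed points of x are counted as points in 2-cycles by the invariant of
    the common centraliser. As x has no 2-cycle, y has exactly two points in
    2-cycles, hence one 2-cycle, and no fixed point; all longer cycles agree. *)
Lemma cycle_type_exceptional x y : 'C[x] = 'C[y] ->
    #|cycle_pts x 1| = 2 -> #|cycle_pts y 1| != 2 ->
  lone2 (cycle_type y) /\ cycle_type x = split2 (cycle_type y).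
Proof.
move=> Cxy x2 y2; have x20 := no_two_cycle Cxy x2 y2.
have ptsy k : 0 < k -> (count_mem k (cycle_type y) * k)%N =
    if k == 1%N then 0 else if k == 2 then 2 else #|cycle_pts x k|.
  move=> k_gt0; rewrite -card_cycle_pts -stab_fixed_pts_cycle // -Cxy.
  by rewrite card_stab_fixed_pts_two // x20 cards0.
have c1 : count_mem 1%N (cycle_type y) = 0.
  by rewrite -[LHS]muln1 ptsy.
have c2 : count_mem 2 (cycle_type y) = 1%N.
  by apply/eqP; rewrite -(@eqn_pmul2r 2) // ptsy.
have lone : lone2 (cycle_type y).
  by rewrite /lone2 c2 -has_pred1 has_count c1.
split=> //; have /and3P[ss s0 _] := is_intpart_split2 (cycle_type_part y).
apply: cycle_type_eq_pts => // k k_gt0; rewrite /split2 lone count_sort /= count_rem.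
have -> : 2 \in cycle_type y by rewrite -has_pred1 has_count c2.
have [<- | k1] := eqVneq 1%N k; first by rewrite /= c1 x2.
have [<- | k2] := eqVneq 2%N k; first by rewrite /= c2 x20 cards0.
rewrite !add0n /= (negPf k2) subn0 ptsy //.
by rewrite !(eq_sym k) (negPf k1) (negPf k2).
Qed.

(** If y has a single 2-cycle (a b) and no fixed point, put x = (a b) y. Both
    centralisers preserve the pair {a, b}, which is the 2-cycle of y and the
    set of fixed points of x; so their elements commute with (a b), and commute
    with x exactly when they commute with y. *)
Lemma lone2_twin y : lone2 (cycle_type y) ->
  exists2 x, 'C[x] = 'C[y] & cycle_type x = split2 (cycle_type y).
Proof.
case/andP=> c1 /eqP c2.
have y1 : cycle_pts y 1 = set0.
  by apply/eqP; rewrite -cards_eq0 card_cycle_pts (count_memPn c1).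
have /cards2P[a [b [ab y2]]] : #|cycle_pts y 2| == 2 by rewrite card_cycle_pts c2.
have not_fixed d : y d != d by rewrite -mem_cycle_pts1 y1 inE.
pose t := tperm a b.
have tC (A : {set T}) g :
    A = [set a; b] -> (forall d, (g d \in A) = (d \in A)) -> commute t g.
  by move=> -> gA; apply: tperm_commute_pair; rewrite ?gA ?set21 ?set22.
have tCy g : g \in 'C[y] -> commute t g.
  by move=> gy; apply: (tC _ _ y2) => d; rewrite mem_cycle_pts.
have yab : y a = b /\ y b = a.
  have mem_y d : y d \in [set a; b] = (d \in [set a; b]).
    by rewrite -y2 mem_cycle_pts ?cent1id.
  split.
    by have := mem_y a; rewrite set21 !inE (negPf (not_fixed a)) => /eqP.
  by have := mem_y b; rewrite set22 !inE (negPf (not_fixed b)) orbF => /eqP.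
pose x := t * y.
have x1 : cycle_pts x 1 = [set a; b].
  apply/setP=> d; rewrite mem_cycle_pts1 permM !inE.
  case: tpermP => [-> | -> | /eqP da /eqP db].
  - by rewrite (proj2 yab) !eqxx.
  - by rewrite (proj1 yab) !eqxx orbT.
  - by rewrite (negPf (not_fixed d)) (negPf da) (negPf db).
have tt : t * t = 1 by rewrite tperm2.
have Cxy : 'C[x] = 'C[y].
  apply/setP=> g; apply/idP/idP=> gC.
    have tg : commute t g by apply: (tC _ _ x1) => d; rewrite mem_cycle_pts.
    have -> : y = t * x by rewrite /x mulgA tt mul1g.
    by apply/cent1P; apply: commuteM; [apply: commute_sym | apply/cent1P].
  apply/cent1P; apply: commuteM; last exact/cent1P.
  exact/commute_sym/tCy.
exists x => //.
have [] // := cycle_type_exceptional Cxy; first by rewrite x1 cards2 ab.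
by rewrite y1 cards0.
Qed.

Lemma zconj_cycle_type x y :
  zconj [set: {perm T}] x y = (split2 (cycle_type x) == split2 (cycle_type y)).
Proof.
have splitC (u v : {perm T}) :
    'C[u] = 'C[v] -> split2 (cycle_type u) = split2 (cycle_type v).
  move=> Cuv; have idem s : split2 (split2 s) = split2 s.
    by rewrite {1}/split2 (negPf (split2_not_lone2 s)).
  have [u2 | u2] := eqVneq #|cycle_pts u 1| 2;
    have [v2 | v2] := eqVneq #|cycle_pts v 1| 2.
  - by rewrite (cycle_type_centraliser Cuv) ?u2 ?v2.
  - by have [_ ->] := cycle_type_exceptional Cuv u2 v2.
  - by have [_ ->] := cycle_type_exceptional (esym Cuv) v2 u2.
  - by rewrite (cycle_type_centraliser Cuv) ?(negPf u2) ?(negPf v2).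
have twin (u : {perm T}) :
  exists2 u', 'C[u'] = 'C[u] & cycle_type u' = split2 (cycle_type u).
  have [/lone2_twin // | not2] := boolP (lone2 (cycle_type u)).
  by exists u; rewrite /split2 ?(negPf not2).
apply/exists_inP/eqP => [[g _] | ].
  by rewrite !setTI -cent1J => /eqP/splitC; rewrite cycle_typeJ.
have [[x' <- <-] [y' <- <-]] := (twin x, twin y).
case/cycle_type_conj=> g <-; exists g; first by rewrite inE.
by rewrite !setTI cent1J.
Qed.

End Centraliser.

(** * Counting z-classes *)

(** The number of values of a function depends only on its kernel. It is
    stated with sequences because the invariant [split2] takes its values in the
    infinite type of sequences. *)
Lemma size_undup_map_kernel (A : Type) (B C : eqType) (f : A -> B) (h : A -> C) s :
    (forall a b, (f a == f b) = (h a == h b)) ->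
  size (undup (map f s)) = size (undup (map h s)).
Proof.
move=> fh; elim: s => //= a s IH.
have ->: (f a \in map f s) = (h a \in map h s).
  by elim: s {IH} => //= b s IH; rewrite !inE fh IH.
by case: ifP => //= _; rewrite IH.
Qed.

Lemma card_zclasses (T : finType) :
  #|zclasses [set: {perm T}]|
    = size (undup [seq split2 (cycle_type x) | x : {perm T}]).
Proof.
pose zclass x := [set y in [set: {perm T}] | zconj [set: {perm T}] x y].
rewrite (@size_undup_map_kernel _ _ _ _ zclass) => [|x y].
  rewrite -(card_uniqP (undup_uniq _)); apply: eq_card => A.
  rewrite mem_undup; apply/imsetP/mapP => [] [x _ ->]; exists x => //.
  by rewrite mem_enum.
rewrite -zconj_cycle_type; apply/idP/eqP => [xy | xy].
  apply/setP=> z; rewrite !inE.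
  by rewrite !zconj_cycle_type in xy *; rewrite (eqP xy).
have: y \in zclass y by rewrite /zclass !inE zconj_cycle_type /=.
by rewrite -xy /zclass !inE.
Qed.

Lemma card_zclasses_parts n :
  #|zclasses [set: 'S_n]| = count (predC lone2) (parts n).
Proof.
rewrite card_zclasses -size_filter; apply/perm_size/uniq_perm => [||s].
- exact: undup_uniq.
- exact/filter_uniq/parts_uniq.
rewrite mem_undup mem_filter mem_parts; apply/mapP/andP => [[x _ ->] | [/= not2 ps]].
  split; first exact: split2_not_lone2.
  by apply: is_intpart_split2; rewrite -{1}(card_ord n) cycle_type_part.
have [|x Dx] := @cycle_type_onto 'I_n s; first by rewrite card_ord.
by exists x; rewrite ?mem_enum // Dx /split2 (negPf not2).
Qed.

Unset Implicit Arguments.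
Import GRing.Theory.
Local Open Scope ring_scope.

Theorem corollary1p2 (n : nat) (hn : (3 <= n)%N) :
  (#|zclasses [set: 'S_n]%G|)%:Z
    = (npart n%:Z)%:Z - (npart_no12 (n - 2)%N)%:Z
  /\
  (#|zclasses [set: 'S_n]%G|)%:Z
    = (npart n%:Z)%:Z - (npart (n%:Z - 2))%:Z + (npart (n%:Z - 3))%:Z
      + (npart (n%:Z - 4))%:Z - (npart (n%:Z - 5))%:Z.
Proof.
have n_ge2 : (2 <= n)%N by apply: ltnW.
have first_formula : (#|zclasses [set: 'S_n]%G|)%:Z
    = (npart n%:Z)%:Z - (npart_no12 (n - 2)%N)%:Z.
  apply/eqP; rewrite eq_sym subr_eq -PoszD -count_lone2 // card_zclasses_parts.
  by rewrite addnC count_predC /= size_parts.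
split=> //; rewrite first_formula.
have inclusion_exclusion :
    (npart_no12 (n - 2) + npart (n%:Z - 3)%R + npart (n%:Z - 4)%R
      = npart (n%:Z - 2)%R + npart (n%:Z - 5)%R)%N.
  have := @npart_no12_inclusion_exclusion (n - 2).
  by rewrite subn_gt0 -subzn // -!addrA -!opprD; apply.
lia.
Qed.
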